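(* Let $K$ be a field, let $G$ be a connected graph on the vertex set $[n]=\{1,\ldots,n\}$, and let $\mathcal{J}_G$ be the binomial edge ideal of $G$ in $R=K[x_1,\ldots,x_n,y_1,\ldots,y_n]$. Suppose that $G$ is not the complete graph and that $\ell$ is the vertex-connectivity of $G$. Then $$\operatorname{depth}(R/\mathcal{J}_G)\leq n-\ell+2\quad\text{and}\quad \operatorname{pd}_R(R/\mathcal{J}_G)\geq n+\ell-2.$$
   Context: All graphs are simple and undirected. For a graph $G$ on $[n]$, the binomial edge ideal is $\mathcal{J}_G=(x_iy_j-x_jy_i : \{i,j\} \text{ an edge of } G)\subseteq R$. For $S\subseteq[n]$, $G\setminus S$ is the induced subgraph on $[n]\setminus S$. The graph $G$ is $\ell$-vertex-connected if $\ell<n$ and for every subset $S$ of vertices with $|S|<\ell$ the graph $G\setminus S$ is connected. The vertex-connectivity of $G$ is the maximum integer $\ell$ such that $G$ is $\ell$-vertex-connected. Here $\operatorname{depth}$ is taken with respect to the homogeneous maximal ideal $(x_1,\ldots,x_n,y_1,\ldots,y_n)$, and $\operatorname{pd}_R$ denotes projective dimension over $R$. *)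

(* Defs.v *)
From HB Require Import structures.
From mathcomp Require Import all_boot all_order all_algebra.
From mathcomp Require Import generic_quotient ring_quotient.
From mathcomp Require Import boolp.
From mathcomp Require Import mpoly.

Set Implicit Arguments.
Unset Strict Implicit.
Unset Printing Implicit Defensive.

Import GRing.Theory.
Local Open Scope ring_scope.

Definition simple_graph (T : finType) (e : rel T) : Prop :=
  ssrbool.symmetric e /\ irreflexive e.

Definition connected_graph (T : finType) (e : rel T) : Prop :=
  forall x y : T, connect e x y.

Definition complete_graph (T : finType) (e : rel T) : Prop :=
  forall x y : T, x != y -> e x y.

Definition delete_vertices (T : finType) (e : rel T) (S : {set T}) :
    rel {x : T | x \notin S} :=
  fun x y => e (val x) (val y).

Definition vertex_connected (T : finType) (e : rel T) (l : nat) : Prop :=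
  (l < #|T|)%N /\
  forall S : {set T}, (#|S| < l)%N -> connected_graph (delete_vertices e (S := S)).

Definition is_vertex_connectivity (T : finType) (e : rel T) (l : nat) : Prop :=
  vertex_connected e l /\ forall k, vertex_connected e k -> (k <= l)%N.

(** The submodule (r_0, ..., r_(s-1)) V of an R-module V.  For V = R^o this is
    the ideal generated by r_0, ..., r_(s-1). *)

Section SequenceSubmodule.
Variables (R : comNzRingType) (V : lmodType R).
Implicit Types (rs : seq R) (v : V).

Definition seq_mul rs v : Prop :=
  exists w : nat -> V, v = \sum_(i < size rs) rs`_i *: w i.

Definition seq_mulb rs : {pred V} := fun v => `[< seq_mul rs v >].

Fact seq_mulb_submod rs : submod_closed (seq_mulb rs).
Proof.
split=> [|a u v]; rewrite /seq_mulb /in_mem /=.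
  apply/asboolP; exists (fun=> 0).
  by rewrite big1 // => i _; rewrite scaler0.
move=> /asboolP[wu ->] /asboolP[wv ->]; apply/asboolP.
exists (fun i => a *: wu i + wv i).
rewrite scaler_sumr -big_split /=; apply: eq_bigr => i _.
by rewrite scalerDr !scalerA mulrC.
Qed.

HB.instance Definition _ rs :=
  GRing.isSubmodClosed.Build R V (seq_mulb rs) (seq_mulb_submod rs).

(** The quotient module V / (r_0, ..., r_(s-1)) V.  The library quotient only
    needs an additive subgroup, despite its name; scalars are added below. *)
Definition seq_quot rs : Type := {ideal_quot seq_mulb rs}.

HB.instance Definition _ rs := GRing.Zmodule.on (seq_quot rs).

Local Open Scope quotient_scope.

Definition seq_quot_scale rs (a : R) (x : seq_quot rs) : seq_quot rs :=
  \pi_(seq_quot rs) (a *: repr x).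

Fact seq_quot_scale_pi rs a v :
  seq_quot_scale a (\pi_(seq_quot rs) v) = \pi_(seq_quot rs) (a *: v).
Proof.
apply/eqP; rewrite /seq_quot_scale -Quotient.idealrBE -scalerBr.
by apply: rpredZ; rewrite Quotient.idealrBE reprK.
Qed.

Fact seq_quot_scaleA rs a b (x : seq_quot rs) :
  seq_quot_scale a (seq_quot_scale b x) = seq_quot_scale (a * b) x.
Proof. by rewrite {2}/seq_quot_scale seq_quot_scale_pi scalerA. Qed.

Fact seq_quot_scale1 rs : left_id 1 (@seq_quot_scale rs).
Proof. by move=> x; rewrite /seq_quot_scale scale1r reprK. Qed.

Fact seq_quot_scaleDr rs : right_distributive (@seq_quot_scale rs) +%R.
Proof.
move=> a x y; rewrite -[x]reprK -[y]reprK.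
by rewrite -raddfD !seq_quot_scale_pi -raddfD scalerDr.
Qed.

Fact seq_quot_scaleDl rs (x : seq_quot rs) :
  {morph (@seq_quot_scale rs)^~ x : a b / a + b}.
Proof. by move=> a b; rewrite /seq_quot_scale scalerDl raddfD. Qed.

HB.instance Definition _ rs :=
  GRing.Zmodule_isLmodule.Build R (seq_quot rs)
    (@seq_quot_scaleA rs) (@seq_quot_scale1 rs)
    (@seq_quot_scaleDr rs) (@seq_quot_scaleDl rs).

End SequenceSubmodule.

Definition regular_sequence (R : comNzRingType) (M : lmodType R) (rs : seq R) :
    Prop :=
  (forall i : nat, (i < size rs)%N -> forall v : M,
     seq_mul (take i rs) (rs`_i *: v) -> seq_mul (take i rs) v) /\
  exists v : M, ~ seq_mul rs v.

(** depth(I, M) is the supremum (possibly infinite) of the lengths of the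
    M-regular sequences contained in I; this says that it is at most k. *)
Definition depth_at_most (R : comNzRingType) (I : R -> Prop) (M : lmodType R)
    (k : nat) : Prop :=
  forall rs : seq R,
    (forall r, r \in rs -> I r) -> regular_sequence M rs -> (size rs <= k)%N.

Definition projective (R : comNzRingType) (P : lmodType R) : Prop :=
  forall (M N : lmodType R) (f : {linear M -> N}) (g : {linear P -> N}),
    (forall y : N, exists x : M, f x = y) ->
    exists h : {linear P -> M}, forall x : P, f (h x) = g x.

Record projective_resolution (R : comNzRingType) (M : lmodType R) := {
  res_obj : nat -> lmodType R;
  res_diff : forall i : nat, {linear res_obj i.+1 -> res_obj i};
  res_aug : {linear res_obj 0%N -> M};
  res_projective : forall i, projective (res_obj i);
  res_aug_surj : forall y : M, exists x, res_aug x = y;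
  res_exact0 : forall x, res_aug x = 0 <-> exists y, res_diff 0%N y = x;
  res_exactS : forall i (x : res_obj i.+1),
    res_diff i x = 0 <-> exists y, res_diff i.+1 y = x
}.

Definition length_at_most (R : comNzRingType) (M : lmodType R)
    (P : projective_resolution M) (p : nat) : Prop :=
  forall i, (p < i)%N -> forall x : res_obj P i, x = 0.

(** pd_R(M) is the infimum (possibly infinite) of the lengths of the projective
    resolutions of M; this says that it is at least k. *)
Definition proj_dim_at_least (R : comNzRingType) (M : lmodType R) (k : nat) :
    Prop :=
  forall (P : projective_resolution M) (p : nat),
    length_at_most P p -> (k <= p)%N.

(** The 2n variables are ordered x_1, ..., x_n, y_1, ..., y_n. *)

Section BinomialEdgeIdeal.
Variables (K : fieldType) (n : nat).

Local Notation R := {mpoly K[n + n]}.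

Definition xvar (i : 'I_n) : R := 'X_(lshift n i).
Definition yvar (i : 'I_n) : R := 'X_(rshift n i).

(** Each edge is listed in both orientations, which only adds opposite
    generators; J_G is the ideal generated by this sequence. *)
Definition edge_binomials (e : rel 'I_n) : seq R :=
  [seq xvar p.1 * yvar p.2 - xvar p.2 * yvar p.1
     | p <- enum [pred p : 'I_n * 'I_n | e p.1 p.2]].

(** R / J_G as an R-module. *)
Definition binomial_edge_ring (e : rel 'I_n) : lmodType R :=
  seq_quot R^o (edge_binomials e).

Definition homogeneous_maximal_ideal : R -> Prop :=
  seq_mul (V := R^o) [seq 'X_i | i <- enum 'I_(n + n)].

End BinomialEdgeIdeal.

(* Main.v *)
(** If ideals A and B satisfy AB <= J while neither lies in J, then the section
    that is 0 on V(B) and 1 on V(A) is a nonzero class in the first Koszul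
    cohomology of A + B with values in M = R/J (Hartshorne's connectedness
    theorem).  By Nakayama, adjoining to A + B a homogeneous system of
    parameters of length d = dim R/(A + B) raises the degree by d, so the Koszul
    cohomology of the maximal ideal on M is nonzero in some degree <= d + 1.
    Hence depth M <= d + 1, and a projective resolution of M has length at least
    2n - (d + 1).

    For J = J_G take A generated by all 2-minors and B by the products of the
    x_v, and of the y_v, over vertex sets U with |U| > n - l.  Two vertices p, q
    are joined by a path with interior in such a U, and expanding along the path
    puts (prod_U x_v) (x_p y_q - x_q y_p) in J_G.  On V(A + B) the matrix has
    rank at most one with at most n - l nonzero columns, so d = n - l + 1. *)

From HB Require Import structures.
Require Import Defs.
From mathcomp Require Import all_boot all_order all_algebra.
From mathcomp Require Import mpoly.
From mathcomp Require Import generic_quotient ring_quotient.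
From mathcomp Require Import boolp freeg zify ring.

Set Implicit Arguments.
Unset Strict Implicit.
Unset Printing Implicit Defensive.

Import Order.TTheory GRing.Theory Num.Theory.
Local Open Scope ring_scope.

(** * Linear maps given as plain functions *)

Lemma linear_props (R : pzRingType) (U V : lmodType R) (f : U -> V) :
  linear f ->
  [/\ f 0 = 0, (forall x y, f (x + y) = f x + f y),
      (forall x y, f (x - y) = f x - f y) & (forall a x, f (a *: x) = a *: f x)].
Proof.
move=> fL; have f0 : f 0 = 0.
  by have := fL (-1) 0 0; rewrite !scaleN1r oppr0 addr0 addNr.
have fZ a x : f (a *: x) = a *: f x by rewrite -[a *: x]addr0 fL f0 addr0.
have fD x y : f (x + y) = f x + f y by rewrite -[x]scale1r fL !scale1r.
by split=> // x y; rewrite fD -scaleN1r fZ scaleN1r.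
Qed.

(** * Cochain complexes and mapping cones *)

(* All the terms of a complex live in one module; [cdeg i] is the submodule of
   the elements of cohomological degree [i].  No directness is required. *)
Record complex (R : comNzRingType) := Complex {
  carrier :> lmodType R;
  diff : carrier -> carrier;
  cdeg : int -> carrier -> Prop;
  diff_linear : linear diff;
  cdeg_lin : forall i a x y, cdeg i x -> cdeg i y -> cdeg i (a *: x + y);
  cdeg0 : forall i, cdeg i 0;
  diff_deg : forall i x, cdeg i x -> cdeg (i + 1) (diff x);
  diffK : forall x, diff (diff x) = 0 }.

Section Complexes.
Variable R : comNzRingType.
Implicit Types (C D : complex R) (i : int) (r : R).

HB.instance Definition _ C :=
  GRing.isLinear.Build R C C _ (@diff R C) (@diff_linear R C).

Lemma diff0 C : diff (0 : C) = 0.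
Proof. exact: linear0. Qed.

Lemma diffN C (x : C) : diff (- x) = - diff x.
Proof. exact: linearN. Qed.

Lemma diffD C (x y : C) : diff (x + y) = diff x + diff y.
Proof. exact: linearD. Qed.

Lemma diffB C (x y : C) : diff (x - y) = diff x - diff y.
Proof. exact: linearB. Qed.

Lemma diffZ C a (x : C) : diff (a *: x) = a *: diff x.
Proof. exact: linearZ. Qed.

Definition exact_at C i : Prop :=
  forall x : C, cdeg i x -> diff x = 0 -> exists2 y : C, cdeg (i - 1) y & diff y = x.

Lemma cdegZ C i a (x : C) : cdeg i x -> cdeg i (a *: x).
Proof. by move=> xi; rewrite -[_ *: _]addr0; apply: cdeg_lin => //; apply: cdeg0. Qed.

Lemma cdegD C i (x y : C) : cdeg i x -> cdeg i y -> cdeg i (x + y).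
Proof. by move=> xi yi; rewrite -[x]scale1r; apply: cdeg_lin. Qed.

Lemma cdegN C i (x : C) : cdeg i x -> cdeg i (- x).
Proof. by move=> xi; rewrite -scaleN1r; apply: cdegZ. Qed.

Lemma cdegB C i (x y : C) : cdeg i x -> cdeg i y -> cdeg i (x - y).
Proof. by move=> xi yi; apply: cdegD => //; apply: cdegN. Qed.

Section Cone.
Variables (r : R) (C : complex R).

Definition cone_carrier : lmodType R := (C * C)%type.
(** The tensor product of [C] with the two-term complex R -> R given by [r] in degrees 0 and 1. With
    this shift of the usual cone, iterated cones are Koszul cochain complexes. *)
Definition cone_diff (p : cone_carrier) : cone_carrier :=
  (diff p.1, r *: p.1 - diff p.2).
Definition cone_deg i (p : cone_carrier) := cdeg i p.1 /\ cdeg (i - 1) p.2.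

Fact cone_diff_linear : linear cone_diff.
Proof.
move=> a x y; rewrite /cone_diff; congr (_, _); rewrite /= diff_linear //.
by rewrite scalerDr scalerBr !scalerA [r * a]mulrC opprD addrACA.
Qed.

Fact cone_deg_lin i a x y : cone_deg i x -> cone_deg i y -> cone_deg i (a *: x + y).
Proof. by move=> [? ?] [? ?]; split; apply: cdeg_lin. Qed.

Fact cone_deg0 i : cone_deg i 0.
Proof. by split; apply: cdeg0. Qed.

Fact cone_diff_deg i x : cone_deg i x -> cone_deg (i + 1) (cone_diff x).
Proof.
move=> [x1 x2]; split; first exact: diff_deg.
rewrite /= addrK; apply: cdegB; first exact: cdegZ.
by rewrite -[i](subrK 1); apply: diff_deg.
Qed.

Fact cone_diffK x : cone_diff (cone_diff x) = 0.
Proof. by rewrite /cone_diff /= diffB diffZ /= !diffK subr0 subrr. Qed.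

Definition cone := Complex cone_diff_linear cone_deg_lin cone_deg0
  cone_diff_deg cone_diffK.

End Cone.

(** The stretch H^(i-1)(C) -> H^i(cone) -> H^i(C) of the long exact sequence, carried out on
    cocycles. *)
Lemma exact_cone r C i : exact_at C i -> exact_at C (i - 1) -> exact_at (cone r C) i.
Proof.
move=> exi exi1 [a b] [/= ai bi] [da rab].
have [u ui du] := exi a ai da.
have [|v vi dv] := exi1 (r *: u - b) (cdegB (cdegZ _ ui) bi).
  by rewrite diffB diffZ /= du.
exists (u, v); first by split.
by congr (_, _) => //=; rewrite dv opprB addrC subrK.
Qed.

(** * Homotopies and retracts *)

Definition nullhomotopic r C : Prop :=
  exists h : C -> C, [/\ linear h, forall i x, cdeg i x -> cdeg (i - 1) (h x)
    & forall x, diff (h x) + h (diff x) = r *: x].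

Lemma nullhomotopic_lin a r s C :
  nullhomotopic r C -> nullhomotopic s C -> nullhomotopic (a * r + s) C.
Proof.
move=> [h [hL hd hr]] [k [kL kd ks]]; exists (fun x => a *: h x + k x); split.
- move=> b x y; rewrite hL kL !scalerDr !scalerA [a * b]mulrC.
  by rewrite addrACA.
- by move=> i x xi; apply: cdeg_lin; auto.
by move=> x; rewrite linearP /= addrACA -scalerDr hr ks scalerDl scalerA.
Qed.

Lemma nullhomotopic0 C : nullhomotopic 0 C.
Proof.
exists (fun=> 0); split=> [a x y|i x _|x].
- by rewrite scaler0 addr0.
- exact: cdeg0.
by rewrite diff0 addr0 scale0r.
Qed.

Lemma nullhomotopic_cone r C : nullhomotopic r (cone r C).
Proof.
exists (fun p => (p.2, 0)); split=> [a x y|i x [_ xi]|[a b]] /=.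
- by congr (_, _); rewrite /= scaler0 addr0.
- by split=> //=; apply: cdeg0.
congr (_, _) => /=; first by rewrite addrC subrK.
by rewrite diff0 subr0 addr0.
Qed.

Lemma cone_nullhomotopic r s C : nullhomotopic r C -> nullhomotopic r (cone s C).
Proof.
move=> [h [hL hd hr]]; have [h0 hD hB hZ] := linear_props hL.
exists (fun p => (h p.1, - h p.2)); split=> [a x y|i x [x1 x2]|[a b]] /=.
- by congr (_, _); rewrite /= hL // opprD scalerN.
- by split=> /=; [exact: hd|exact/cdegN/hd].
congr (_, _) => /=; first exact: hr.
by rewrite diffN opprK hB hZ opprB addrC addrA subrK addrC hr.
Qed.

(** If r z = d y, then (z, y) is a cocycle of the cone, so exactness of the cone makes [r] injective
    on H^i(C). The homotopy makes [r ^+ N] zero there, hence H^i(C) = 0. *)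
Lemma exact_cone_nullhomotopic r N C i :
  nullhomotopic (r ^+ N) C -> exact_at (cone r C) i -> exact_at C i.
Proof.
move=> [h [hL hd hr]] ex x xi dx; have [h0 _ _ _] := linear_props hL.
have step (z : C) : cdeg i z -> diff z = 0 ->
    (exists2 y, cdeg (i - 1) y & diff y = r *: z) ->
    exists2 y, cdeg (i - 1) y & diff y = z.
  move=> zi dz [y yi dy].
  have [||[u v] [/= ui _] [du _]] := ex (z, y).
  - by split.
  - by congr (_, _) => //=; rewrite dy subrr.
  by exists u.
have: exists2 y, cdeg (i - 1) y & diff y = r ^+ N *: x.
  by exists (h x); [exact: hd|rewrite -hr dx h0 addr0].
elim: N {hr} => [|N IH]; first by rewrite scale1r.
rewrite exprS -scalerA => /step H; apply/IH/H; first exact: cdegZ.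
by rewrite diffZ /= dx scaler0.
Qed.

(** A one-sided inverse transfers exactness from [D] to [C]; this covers reorderings of a sequence
    as well as direct summands of modules. *)
Definition retract C D : Prop :=
  exists (f : C -> D) (g : D -> C),
  [/\ linear f /\ linear g,
      (forall i x, cdeg i x -> cdeg i (f x)) /\ (forall i x, cdeg i x -> cdeg i (g x)),
      (forall x, diff (f x) = f (diff x)) /\ (forall x, diff (g x) = g (diff x))
    & forall x, g (f x) = x].

Lemma retract_refl C : retract C C.
Proof. by exists id, id. Qed.

Lemma retract_trans C D E : retract C D -> retract D E -> retract C E.
Proof.
move=> [f [g [[fL gL] [fd gd] [fD gD] gf]]] [f' [g' [[fL' gL'] [fd' gd'] [fD' gD'] gf']]].
exists (f' \o f), (g \o g'); split=> [||| x] /=; last by rewrite gf' gf.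
- by split=> a x y /=; [rewrite fL fL'|rewrite gL' gL].
- by split=> *; [apply/fd'/fd|apply/gd/gd'].
- by split=> x /=; [rewrite fD' fD|rewrite gD gD'].
Qed.

Lemma exact_retract C D i : retract C D -> exact_at D i -> exact_at C i.
Proof.
move=> [f [g [[fL gL] [fd gd] [fD gD] gf]]] ex x xi dx.
have f0 : f 0 = 0 by case: (linear_props fL).
have [|y yi dy] := ex (f x) (fd _ _ xi); first by rewrite fD dx f0.
by exists (g y); [exact: gd|rewrite gD dy gf].
Qed.

Lemma retract_cone r C D : retract C D -> retract (cone r C) (cone r D).
Proof.
move=> [f [g [[fL gL] [fd gd] [fD gD] gf]]].
have [[_ _ fB fZ] [_ _ gB gZ]] := (linear_props fL, linear_props gL).
exists (fun p => (f p.1, f p.2)), (fun p => (g p.1, g p.2)).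
split=> [||| [a b]]; last by rewrite /= !gf.
- by split=> a x y; congr (_, _) => /=; rewrite ?fL ?gL.
- by split=> i x [x1 x2]; split=> /=; auto.
- by split=> x; congr (_, _) => /=; rewrite ?fB ?fZ ?gB ?gZ ?fD ?gD.
Qed.

Lemma retract_cone_swap r s C : retract (cone r (cone s C)) (cone s (cone r C)).
Proof.
(* The sign on the last component makes the exchange of the two middle ones a chain map. *)
pose f (p : (C * C) * (C * C)) := ((p.1.1, p.2.1), (p.1.2, - p.2.2)).
exists f, f; rewrite /f; split=> [||| [[a b] [c d]]] /=; last by rewrite opprK.
- by split=> a [[? ?] [? ?]] [[? ?] [? ?]]; congr (_, _); congr (_, _);
  rewrite /= opprD scalerN.
- by split=> i [[a b] [c d]] [[/= ? ?] [/= ? ?]]; do !split => //=; apply: cdegN.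
split=> -[[a b] [c d]]; congr (_, _); congr (_, _); rewrite /= diffN opprK /=;
by rewrite opprB opprD addrA addrAC.
Qed.

End Complexes.

(** * Submodules generated by sequences *)

Section SeqMul.
Variables (R : comNzRingType) (V : lmodType R).
Implicit Types (rs : seq R) (v : V).

Lemma seq_mul_lin rs a u v : seq_mul rs u -> seq_mul rs v -> seq_mul rs (a *: u + v).
Proof.
have [_ H] := seq_mulb_submod V rs => /asboolP u1 /asboolP v1.
exact/asboolP/(H a).
Qed.

Lemma seq_mul0 rs : seq_mul rs (0 : V).
Proof. by have [H _] := seq_mulb_submod V rs; apply/asboolP. Qed.

Lemma seq_mulZ rs a v : seq_mul rs v -> seq_mul rs (a *: v).
Proof. by move=> ?; rewrite -[_ *: _]addr0; apply/seq_mul_lin/seq_mul0. Qed.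

Lemma seq_mulD rs u v : seq_mul rs u -> seq_mul rs v -> seq_mul rs (u + v).
Proof. by move=> ? ?; rewrite -[u]scale1r; apply: seq_mul_lin. Qed.

Lemma seq_mulB rs u v : seq_mul rs u -> seq_mul rs v -> seq_mul rs (u - v).
Proof. by move=> ? ?; rewrite addrC -scaleN1r; apply: seq_mul_lin. Qed.

Lemma seq_mul_sum rs (I : eqType) (s : seq I) (P : pred I) (F : I -> V) :
  (forall j, j \in s -> P j -> seq_mul rs (F j)) -> seq_mul rs (\sum_(j <- s | P j) F j).
Proof.
move=> FP; rewrite big_seq_cond.
elim/big_rec: _ => [|j x /andP[js Pj]]; first exact: seq_mul0.
exact/seq_mulD/FP.
Qed.

Lemma seq_mul_mem rs r v : r \in rs -> seq_mul rs (r *: v).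
Proof.
move=> rrs; have lt : (index r rs < size rs)%N by rewrite index_mem.
exists (fun j => if j == index r rs then v else 0).
rewrite (bigD1 (Ordinal lt)) //= nth_index // eqxx big1 ?addr0 // => j /negPf.
by rewrite -(inj_eq val_inj) /= => ->; rewrite scaler0.
Qed.

Lemma seq_mul_ind rs (P : V -> Prop) :
  P 0 -> (forall u v, P u -> P v -> P (u + v)) ->
  (forall r v, r \in rs -> P (r *: v)) -> forall v, seq_mul rs v -> P v.
Proof.
move=> P0 PD Prs v [w ->]; elim/big_rec: _ => // i x _.
by apply/PD/Prs/mem_nth.
Qed.

Lemma seq_mul_sub rs rs' v : {subset rs <= rs'} -> seq_mul rs v -> seq_mul rs' v.
Proof.
move=> sub; elim/seq_mul_ind => [|u w|r w /sub]; first exact: seq_mul0.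
  exact: seq_mulD.
exact: seq_mul_mem.
Qed.

Lemma seq_mul_cons r rs v :
  seq_mul (r :: rs) v -> exists w v', seq_mul rs v' /\ v = r *: w + v'.
Proof.
elim/seq_mul_ind => [|u w [a [u' [? ->]]] [b [w' [? ->]]]|s w].
- by exists 0, 0; rewrite scaler0 addr0; split=> //; apply: seq_mul0.
- exists (a + b), (u' + w'); split; first exact: seq_mulD.
  by rewrite scalerDr addrACA.
rewrite inE => /predU1P[->|srs].
  by exists w, 0; rewrite addr0; split=> //; apply: seq_mul0.
by exists 0, (s *: w); rewrite scaler0 add0r; split=> //; apply: seq_mul_mem.
Qed.

End SeqMul.

Definition in_radical (R : comNzRingType) (rs : seq R) (r : R) : Prop :=
  exists N, seq_mul (V := R^o) rs (r ^+ N).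

(** * Koszul complexes *)

Section Koszul.
Variable R : comNzRingType.
Implicit Types (M : lmodType R) (rs : seq R) (r : R) (C : complex R) (i g : int).

Definition module_deg M i (x : M) : Prop := i != 0 -> x = 0.

Fact module_deg_lin M i a (x y : M) :
  module_deg i x -> module_deg i y -> module_deg i (a *: x + y).
Proof. by move=> x0 y0 i0; rewrite x0 // y0 // scaler0 addr0. Qed.

Definition module_complex M : complex R.
Proof.
refine (@Complex R M (fun=> 0) (@module_deg M) _ (@module_deg_lin M) _ _ _) => //.
by move=> a x y; rewrite scaler0 addr0.
Defined.

Fixpoint koszul rs M : complex R :=
  if rs is r :: rs' then cone r (koszul rs' M) else module_complex M.

Lemma koszul_cat rs rs' M :
  koszul (rs ++ rs') M = foldr (@cone R) (koszul rs' M) rs.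
Proof. by elim: rs => //= r rs ->. Qed.

Lemma retract_koszul_insert r rs rs' M :
  retract (koszul (r :: rs ++ rs') M) (koszul (rs ++ r :: rs') M).
Proof.
elim: rs => [|a rs IH] /=; first exact: retract_refl.
exact/(retract_trans (retract_cone_swap _ _ _))/retract_cone.
Qed.

Lemma retract_koszul_catC rs rs' M :
  retract (koszul (rs ++ rs') M) (koszul (rs' ++ rs) M).
Proof.
elim: rs => [|r rs IH]; first by rewrite cats0; apply: retract_refl.
exact/(retract_trans (retract_cone r IH))/retract_koszul_insert.
Qed.

(** Each generator is contracted by its own cone and stays contracted under the later cones; the
    scalars admitting a contraction form an ideal. *)
Lemma nullhomotopic_koszul rs r M :
  seq_mul (V := R^o) rs r -> nullhomotopic r (koszul rs M).
Proof.
have gen s : s \in rs -> nullhomotopic s (koszul rs M).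
  elim: rs => // t rs IH; rewrite inE => /predU1P[->|/IH srs].
    exact: nullhomotopic_cone.
  exact: cone_nullhomotopic.
elim/seq_mul_ind => [|u v nu nv|s v /gen ns]; first exact: nullhomotopic0.
  by rewrite -[u]mul1r; apply: nullhomotopic_lin.
rewrite /GRing.scale /= mulrC -[_ * _]addr0.
exact/nullhomotopic_lin/nullhomotopic0.
Qed.

Lemma exact_foldr_cone rs C g :
  (forall i, i <= g -> exact_at C i) ->
  forall i, i <= g -> exact_at (foldr (@cone R) C rs) i.
Proof.
move=> exC; elim: rs => //= r rs IH i ig.
by apply: exact_cone; apply: IH => //; lia.
Qed.

Lemma nullhomotopic_foldr_cone rs r C :
  nullhomotopic r C -> nullhomotopic r (foldr (@cone R) C rs).
Proof. by move=> rC; elim: rs => //= s rs; apply: cone_nullhomotopic. Qed.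

(* Depth sensitivity of Koszul cohomology: compare both with the Koszul complex
   of the concatenation, in either order. *)
Lemma exact_koszul_radical rs rs' M g :
  (forall r, r \in rs -> in_radical rs' r) ->
  (forall i, i <= g -> exact_at (koszul rs M) i) ->
  forall i, i <= g -> exact_at (koszul rs' M) i.
Proof.
move=> rad exrs i ig.
have: exact_at (koszul (rs ++ rs') M) i.
  apply: (exact_retract (retract_koszul_catC _ _ _)).
  by rewrite koszul_cat; apply: exact_foldr_cone exrs _ ig.
elim: rs rad {exrs} => //= r rs IH rad /exact_cone_nullhomotopic ex.
have [N rN] := rad r (mem_head _ _).
apply: IH => [s srs|]; first by apply: rad; rewrite inE srs orbT.
apply: (ex N); rewrite koszul_cat.
exact/nullhomotopic_foldr_cone/nullhomotopic_koszul.
Qed.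

(** * Top Koszul cohomology and regular sequences *)

Fixpoint koszul_top rs M : koszul rs M -> M :=
  if rs is r :: rs' then fun p => koszul_top p.2 else id.

Lemma koszul_top_linear rs M : linear (@koszul_top rs M).
Proof. by elim: rs => //= r rs IH a x y; rewrite IH. Qed.

Lemma cdeg_koszul_gt rs M i (x : koszul rs M) : (size rs)%:Z < i -> cdeg i x -> x = 0.
Proof.
elim: rs i x => [|r rs IH] i /=; first by move=> x i0; apply; lia.
case=> a b lti [/= da db].
have lti1 : (size rs)%:Z < i - 1 by clear -lti; lia.
have lti0 : (size rs)%:Z < i by clear -lti; lia.
by congr (_, _); [apply: IH lti0 da|apply: IH lti1 db].
Qed.

Lemma koszul_top_surj rs M (m : M) :
  exists2 x : koszul rs M, cdeg (size rs)%:Z x & koszul_top x = m.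
Proof.
elim: rs => [|r rs [x xd xm]] /=; first by exists m.
exists (0, x) => //; split=> /=; first exact: cdeg0.
by rewrite (_ : _ - 1 = (size rs)%:Z) //; lia.
Qed.

Lemma koszul_top_diff rs M (x : koszul rs M) : seq_mul rs (koszul_top (diff x)).
Proof.
elim: rs x => [|r rs IH] /=; first by move=> _; apply: seq_mul0.
case=> a b /=; have [_ _ -> ->] := linear_props (@koszul_top_linear rs M).
apply: seq_mulB; first by apply: seq_mul_mem; rewrite mem_head.
by apply: (seq_mul_sub _ (IH b)) => s; rewrite inE orbC => ->.
Qed.

(** Together with [koszul_top_diff], this identifies the top cohomology with M/(rs)M. A lift [u] of
    the coefficient of [r] accounts for the first generator, and the remainder is a coboundary by
    induction. *)
Lemma koszul_top_exact rs M (x : koszul rs M) :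
  cdeg (size rs)%:Z x -> seq_mul rs (koszul_top x) ->
  exists2 y : koszul rs M, cdeg ((size rs)%:Z - 1) y & diff y = x.
Proof.
elim: rs x => [|r rs IH] /=.
  by move=> x _ [w ->]; exists 0; rewrite ?big_ord0.
case=> a b [/= da db] /seq_mul_cons[w [v [vrs top]]].
have sz : (size rs).+1%:Z - 1 = (size rs)%:Z by lia.
rewrite sz in db *.
have [u du uw] := koszul_top_surj rs w.
have [_ _ tB tZ] := linear_props (@koszul_top_linear rs M).
have [||y dy yb] := IH (b - r *: u); first by apply: cdegB => //; apply: cdegZ.
  by rewrite tB tZ uw top addrC addKr.
exists (u, - y); first by split=> //=; apply: cdegN.
congr (_, _) => /=; last by rewrite diffN opprK yb addrC subrK.
rewrite (cdeg_koszul_gt _ da); last by lia.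
by apply: (cdeg_koszul_gt _ (diff_deg du)); lia.
Qed.

Definition weakly_regular M rs : Prop :=
  forall i : nat, (i < size rs)%N -> forall v : M,
    seq_mul (take i rs) (rs`_i *: v) -> seq_mul (take i rs) v.

(** The sequence is reversed because [koszul] puts its first entry outermost, while regularity
    adjoins the last one. The only new degree is the top one of the shorter complex, where the
    cohomology is M/(rs)M and [r] acts injectively. *)
Lemma exact_koszul_regular M rs :
  weakly_regular M rs ->
  forall i, i < (size rs)%:Z -> exact_at (koszul (rev rs) M) i.
Proof.
elim/last_ind: rs => [_ i i0 x|rs r IH reg i].
  by move=> xi _; exists 0 => //=; rewrite xi // lt_eqF.
rewrite rev_rcons size_rcons => ilt /=.
have {}IH : forall i, i < (size rs)%:Z -> exact_at (koszul (rev rs) M) i.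
  apply: IH => j jlt v; have := reg j; rewrite size_rcons nth_rcons jlt -cats1.
  rewrite takel_cat 1?ltnW // => H; exact: H.
have [ilt'|ige] := ltP i (size rs)%:Z; first by apply: exact_cone; apply: IH; lia.
have {ilt ige}-> : i = (size rs)%:Z by lia.
case=> a b [/= da db] [_ /= rab].
have [_ _ _ tZ] := linear_props (@koszul_top_linear (rev rs) M).
have sub : {subset rev rs <= rs} by move=> s; rewrite mem_rev.
have [||u du ua] := @koszul_top_exact (rev rs) M a.
- by rewrite size_rev.
- have H : seq_mul rs (koszul_top a).
    have := reg (size rs); rewrite size_rcons nth_rcons ltnn eqxx -cats1 take_size_cat //.
    apply=> //; apply: (seq_mul_sub sub).
    by rewrite -tZ -[r *: a](subrK (diff b)) rab add0r; apply: koszul_top_diff.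
  by apply: seq_mul_sub H => s; rewrite mem_rev.
rewrite size_rev in du.
have lt : (size rs)%:Z - 1 < size rs by lia.
have [||v dv vb] := IH _ lt (r *: u - b).
- exact/cdegB/db/cdegZ.
- by rewrite diffB diffZ /= ua.
exists (u, v); first by split.
by congr (_, _) => //=; rewrite vb opprB addrC subrK.
Qed.

End Koszul.

(** * Functoriality and projective dimension *)

Section KoszulMap.
Variable R : comNzRingType.
Implicit Types (L M N P : lmodType R) (rs : seq R) (i : int).

Fixpoint koszul_map rs M N (f : M -> N) : koszul rs M -> koszul rs N :=
  if rs is r :: rs' then fun p => (koszul_map f p.1, koszul_map f p.2) else f.

Lemma koszul_map_linear rs M N (f : M -> N) :
  linear f -> linear (@koszul_map rs M N f).
Proof. by move=> fL; elim: rs => //= r rs IH a x y; rewrite !IH. Qed.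

Lemma koszul_map_deg rs M N (f : M -> N) i (x : koszul rs M) :
  linear f -> cdeg i x -> cdeg i (koszul_map f x).
Proof.
move=> /linear_props[f0 _ _ _]; elim: rs i x => [|r rs IH] i x.
  by move=> xi i0; rewrite xi.
by case=> x1 x2; split; apply: IH.
Qed.

Lemma koszul_map_diff rs M N (f : M -> N) (x : koszul rs M) :
  linear f -> diff (koszul_map f x) = koszul_map f (diff x).
Proof.
move=> fL; elim: rs x => [|r rs IH] x /=; first by case: (linear_props fL).
have [_ _ fB fZ] := linear_props (@koszul_map_linear rs M N f fL).
by congr (_, _) => /=; rewrite ?fB ?fZ ?IH.
Qed.

Lemma koszul_map_surj rs M N (f : M -> N) i (y : koszul rs N) :
  linear f -> (forall v, exists u, f u = v) -> cdeg i y ->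
  exists2 x : koszul rs M, cdeg i x & koszul_map f x = y.
Proof.
move=> /linear_props[f0 _ _ _] fS; elim: rs i y => [|r rs IH] i y /=.
  have [i0 _|i0 ->//] := eqVneq i 0; last by exists 0.
  by have [u <-] := fS y; exists u => //; rewrite i0.
by case: y => a b [/= /IH[u ui <-] /IH[v vi <-]]; exists (u, v).
Qed.

(** Each degree of a Koszul complex is a finite power of the module, so exactness holds
    componentwise. *)
Lemma koszul_map_exact rs L M N (g : L -> M) (f : M -> N) i (x : koszul rs M) :
  linear g -> (forall u, f u = 0 -> exists v, g v = u) ->
  cdeg i x -> koszul_map f x = 0 ->
  exists2 y : koszul rs L, cdeg i y & koszul_map g y = x.
Proof.
move=> /linear_props[g0 _ _ _] gf; elim: rs i x => [|r rs IH] i x /=.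
  have [i0 _|i0 ->// _] := eqVneq i 0; last by exists 0.
  by move=> /gf[u <-]; exists u => //; rewrite i0.
case: x => a b [/= ai bi] [/(IH _ _ ai)[u ui <-] /(IH _ _ bi)[v vi <-]].
by exists (u, v).
Qed.

Lemma koszul_map_comp0 rs L M N (g : L -> M) (f : M -> N) (x : koszul rs L) :
  (forall u, f (g u) = 0) -> koszul_map f (koszul_map g x) = 0.
Proof. by move=> fg; elim: rs x => //= r rs IH [a b]; rewrite !IH. Qed.

Lemma koszul_trivial rs M (x : koszul rs M) : (forall u : M, u = 0) -> x = 0.
Proof. by move=> M0; elim: rs x => [|r rs IH] //= [a b]; rewrite (IH a) (IH b). Qed.

Lemma koszul_retract rs M N (f : {linear M -> N}) (g : {linear N -> M}) :
  (forall u, g (f u) = u) -> retract (koszul rs M) (koszul rs N).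
Proof.
move=> gf; have [fL gL] : linear f /\ linear g by split=> a x y; rewrite linearP.
exists (@koszul_map rs M N f), (@koszul_map rs N M g); split.
- by split; apply: koszul_map_linear.
- by split=> i x; apply: koszul_map_deg.
- by split=> x; apply: koszul_map_diff.
by elim: rs => //= r rs IH [a b]; rewrite /= !IH.
Qed.

(** A chase in the double complex of the Koszul complexes of the resolution, which are exact below
    degree [size rs]. A cocycle over [M] in degree i moves to degree i + j over term j of the
    resolution. If the length is less than [q], the terms run out while the degrees needed are still
    below [size rs], so the cocycle is a coboundary. *)
Lemma proj_dim_koszul rs M i q :
  (forall P, projective P ->
     forall j, j < (size rs)%:Z -> exact_at (koszul rs P) j) ->
  ~ exact_at (koszul rs M) i -> i + q%:Z <= (size rs)%:Z -> proj_dim_at_least M q.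
Proof.
move=> exP nexM iq F p lenF; rewrite leqNgt; apply/negP => pq; apply: nexM.
have dL j : linear (res_diff F j) by move=> a x y; rewrite linearP.
have aL : linear (res_aug F) by move=> a x y; rewrite linearP.
pose kd j := @koszul_map rs _ _ (res_diff F j).
pose ka := @koszul_map rs _ _ (res_aug F).
have d2 j u : res_diff F j (res_diff F j.+1 u) = 0.
  by apply/res_exactS; exists u.
have ad u : res_aug F (res_diff F 0 u) = 0 by apply/res_exact0; exists u.
have dex j u : res_diff F j u = 0 -> exists v, res_diff F j.+1 v = u.
  by move/res_exactS.
have aex u : res_aug F u = 0 -> exists v, res_diff F 0 v = u by move/res_exact0.
have exF k j : j < (size rs)%:Z -> exact_at (koszul rs (res_obj F k)) j.
  exact/exP/(@res_projective _ _ F).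
have triv k (x : koszul rs (res_obj F k)) : (p < k)%N -> x = 0.
  by move=> pk; apply/koszul_trivial/lenF.
(* Descending induction on j, with [m] counting the distance to q. For m = 0 the term of index j + 1
   = q lies beyond the length p, so [y] is 0. *)
have claim m j (y : koszul rs (res_obj F j.+1)) : (j.+1 + m)%N = q ->
    cdeg (i + j.+1%:Z) y -> kd j (diff y) = 0 ->
    exists u w, [/\ cdeg (i + j%:Z) u, cdeg (i + j.+1%:Z) w & y = diff u + kd j.+1 w].
  elim: m j y => [|m IH] j y jm yi dy.
    exists 0, 0; split; [exact: cdeg0|exact: cdeg0|].
    by have pj : (p < j.+1)%N; [lia|rewrite [LHS]triv // [RHS]triv].
  have ddy : cdeg (i + j.+2%:Z) (diff y).
    by rewrite (_ : _ + _ = i + j.+1%:Z + 1); [exact: diff_deg|lia].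
  have [y' y'i dy'] := koszul_map_exact (dL j.+1) (dex j) ddy dy.
  have [|||u [w [ui wi y'E]]] := IH j.+1 y' => //; first by lia.
    by rewrite /kd -(koszul_map_diff _ (dL j.+1)) dy' diffK.
  have [_ kD _ _] := linear_props (koszul_map_linear (dL j.+1) (rs := rs)).
  have ki : cdeg (i + j.+1%:Z) (kd j.+1 u) by apply: koszul_map_deg.
  have ilt : i + j.+1%:Z < size rs by clear -jm iq; lia.
  have [||v vi vE] := exF j.+1 _ ilt (y - kd j.+1 u).
  - exact: cdegB.
  - by rewrite diffB -dy' y'E /kd kD (koszul_map_diff _ (dL j.+1))
      (koszul_map_comp0 _ (d2 j.+1)) addr0 subrr.
  exists v, u; split=> //; last by rewrite vE subrK.
  by rewrite (_ : i + j%:Z = i + j.+1%:Z - 1) //; lia.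
move=> x xi dx.
(* A lift [y] of [x] to term 0 is corrected by [claim] to a cocycle; the image of its primitive [v]
   is a primitive of [x]. *)
have [y yi yx] := koszul_map_surj aL (res_aug_surj F) xi.
have [|y' y'i dy'] := koszul_map_exact (dL 0%N) aex (diff_deg yi).
  by rewrite -(koszul_map_diff _ aL) yx.
have [|||u [w [ui wi y'E]]] := claim q.-1 0%N y' => //; first by lia.
  by rewrite /kd -(koszul_map_diff _ (dL 0%N)) dy' diffK.
have [_ kD _ _] := linear_props (koszul_map_linear (dL 0%N) (rs := rs)).
have [_ aD aB _] := linear_props (koszul_map_linear aL (rs := rs)).
have ki : cdeg i (kd 0%N u) by apply: koszul_map_deg => //; rewrite -[i]addr0.
have ilt : i < size rs by clear -iq pq; lia.
have [||v vi vE] := exF 0%N _ ilt (y - kd 0%N u).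
- exact: cdegB.
- by rewrite diffB -dy' y'E /kd kD (koszul_map_diff _ (dL 0%N))
    (koszul_map_comp0 _ (d2 0%N)) addr0 subrr.
exists (ka v); first exact: koszul_map_deg.
by rewrite (koszul_map_diff _ aL) vE aB yx (koszul_map_comp0 _ ad) subr0.
Qed.

(** * Regularity on free modules and exactness for projective ones *)

Lemma weakly_regular_freeg rs (K : choiceType) :
  weakly_regular R^o rs -> weakly_regular {freeg K / R} rs.
Proof.
move=> reg i ilt v [w vE].
(* Elements have finite support, so regularity can be tested on one coefficient at a time. *)
rewrite -(freeg_sumE v); apply: seq_mul_sum => s _ _.
have: seq_mul (V := R^o) (take i rs) (coeff s v).
  apply: reg => //; exists (fun j => coeff s (w j)).
  rewrite /GRing.scale /= -coeffZ vE raddf_sum; apply: eq_bigr => j _.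
  by rewrite /= coeffZ.
elim/seq_mul_ind => [|a b|r a rin]; first by rewrite freegU0; apply: seq_mul0.
  by rewrite -freegUD; apply: seq_mulD.
have ->: << (r *: a) *g s >> = r *: << a *g s >> :> {freeg K / R}.
  by apply/eqP/freeg_eqP => t; rewrite coeffZ !coeffU mulrA.
exact: seq_mul_mem.
Qed.

Lemma fglift_linear (K : choiceType) M (f : K -> M) :
  linear (fglift f : {freeg K / R} -> M).
Proof.
pose gA := GRing.isAdditive.Build {freeg K / R} M (fglift f) (lift_is_additive f).
pose g : {additive {freeg K / R} -> M} := HB.pack (fglift f) gA.
have gU k s : g << k *g s >> = k *: f s := liftU f k s.
move=> a x y; rewrite -/(g : _ -> _) [LHS](raddfD g); congr (_ + _).
rewrite -[in LHS](freeg_sumE x) scaler_sumr [LHS](raddf_sum g).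
rewrite -[in RHS](freeg_sumE x).
transitivity (a *: \sum_(s <- dom x) g << coeff s x *g s >>).
  rewrite scaler_sumr; apply: eq_bigr => s _; rewrite gU scalerA -gU; congr (g _).
  by apply/eqP/freeg_eqP => t; rewrite coeffZ !coeffU mulrA.
by congr (a *: _); rewrite [RHS](raddf_sum g).
Qed.

(** A projective module is a retract of the free module on its own elements, by lifting the
    identity. *)
Lemma exact_koszul_projective rs P :
  weakly_regular R^o rs -> projective P ->
  forall i, i < (size rs)%:Z -> exact_at (koszul (rev rs) P) i.
Proof.
move=> reg projP i ilt.
pose F : lmodType R := {freeg P / R}.
pose f0 : F -> P := fglift id.
pose fL := GRing.isLinear.Build R F P _ f0 (@fglift_linear P P id).
pose f : {linear F -> P} := HB.pack f0 fL.
have [|h fh] := projP F P f idfun.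
  by move=> y; exists << y >>; rewrite /= /f0 liftU scale1r.
apply: (@exact_retract _ _ (koszul (rev rs) F)); first exact: koszul_retract fh.
exact/exact_koszul_regular/ilt/weakly_regular_freeg.
Qed.

End KoszulMap.

(** * Graded complexes *)

Section Graded.
Variables (R : comNzRingType) (hom : nat -> R -> Prop).
Implicit Types (C : complex R) (i : int).

(** An internal grading in degrees >= 0, given by its component maps [pr k] and separate from the
    cohomological degree. A scalar of degree [e] shifts the components by [e]. *)
Definition graded C : Prop :=
  exists pr : nat -> C -> C,
  [/\ forall k x y, pr k (x + y) = pr k x + pr k y,
      forall k i x, cdeg i x -> cdeg i (pr k x),
      forall k x, diff (pr k x) = pr k (diff x),
      forall x, exists N, forall n, (N <= n)%N -> x = \sum_(k < n) pr k x &
      forall e r k x, hom e r ->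
        pr k (r *: x) = if (e <= k)%N then r *: pr (k - e)%N x else 0].

(** Shifting the first copy of [C] by the degree of [r] makes the differential of the cone preserve
    the internal degree. *)
Lemma graded_cone C e r : hom e r -> graded C -> graded (cone r C).
Proof.
move=> er [pr [prD prd prdiff prfin prhom]].
pose sh k x := if (e <= k)%N then pr (k - e)%N x else 0.
have prB k x y : pr k (x - y) = pr k x - pr k y.
  by apply: (addIr (pr k y)); rewrite -prD !subrK.
exists (fun k p => (sh k p.1, pr k p.2)); split=> /=.
- by move=> k x y; rewrite /sh; case: leqP => _; congr (_, _); rewrite /= ?prD ?addr0.
- move=> k i x [/= x1 x2]; split=> /=; last exact: prd.
  by rewrite /sh; case: leqP => _; [apply: prd|apply: cdeg0].
- move=> k [a b] /=; congr (_, _); rewrite /= /sh.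
    by case: leqP => _; rewrite ?prdiff ?diff0.
  by rewrite prB (prhom e) // prdiff; case: leqP => _ //; rewrite scaler0.
- move=> [a b]; have [[N Na] [N' Nb]] := (prfin a, prfin b).
  exists (maxn (N + e) N') => n; rewrite geq_max => /andP[nN nN'].
  rewrite (eq_bigr (fun k : 'I_n => (sh k a, 0) + (0, pr k b))); last first.
    by move=> k _; congr (_, _) => /=; rewrite ?addr0 ?add0r.
  have sum1 (F : 'I_n -> C) : \sum_k (F k, 0 : C) = (\sum_k F k, 0).
    by elim/big_ind2: _ => // x u y v -> ->; congr (_, _); rewrite addr0.
  have sum2 (F : 'I_n -> C) : \sum_k (0 : C, F k) = (0, \sum_k F k).
    by elim/big_ind2: _ => // x u y v -> ->; congr (_, _); rewrite addr0.
  rewrite big_split /= sum1 sum2; congr (_, _) => /=; last by rewrite add0r -Nb.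
  rewrite addr0 -(big_mkord xpredT (sh^~ a)) (big_cat_nat (n := e)) //=; last by lia.
  rewrite big_nat big1 ?add0r => [|k /andP[_ ke]]; last by rewrite /sh leqNgt ke.
  rewrite -{1}[e]add0n big_addn big_mkord {1}(Na (n - e)%N); last by lia.
  by apply: eq_bigr => k _; rewrite /sh leq_addl addnK.
move=> f s k x fs; rewrite /= (prhom f) // /sh.
have [fk|kf] := leqP f k; have [ek|ke] := leqP e k; rewrite ?(prhom f) //.
- have [ekf|kef] := leqP e (k - f)%N.
    by rewrite ifT; [congr (_, _); rewrite /= subnAC|lia].
  by rewrite ifF; [congr (_, _); rewrite /= scaler0|lia].
- by rewrite ifF; [congr (_, _); rewrite /= scaler0|lia].
by rewrite ifF //; lia.
Qed.

(** A graded Nakayama argument. Applied to (0, x), exactness of the cone makes [r] surjective on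
    H^i(C). Component k of a class is then [r] times component k - e of another, or zero if k < e,
    and induction on k kills it. *)
Lemma graded_nakayama C i e r :
  hom e r -> (0 < e)%N -> graded C -> exact_at (cone r C) (i + 1) -> exact_at C i.
Proof.
move=> er e0 [pr [prD prd prdiff prfin prhom]] ex.
have prB k x y : pr k (x - y) = pr k x - pr k y.
  by apply: (addIr (pr k y)); rewrite -prD !subrK.
have claim k x : cdeg i x -> diff x = 0 ->
    exists2 y, cdeg (i - 1) y & diff y = pr k x.
  elim/ltn_ind: k x => k IH x xi dx.
  have [||[u v] [/= ui vi] [du uv]] := ex (0, x).
  - by split=> /=; [exact: cdeg0|rewrite addrK].
  - by congr (_, _) => /=; rewrite ?diff0 // dx scaler0 subr0.
  rewrite addrK in ui vi.
  rewrite -uv prB (prhom e) // -prdiff; case: leqP => ek; last first.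
    by exists (- pr k v); [exact/cdegN/prd|rewrite diffN sub0r].
  have [|y yi <-] := IH (k - e)%N _ u ui du; first by lia.
  exists (r *: y - pr k v); first by apply: cdegB; [exact: cdegZ|exact: prd].
  by rewrite diffB diffZ.
move=> x xi dx; have [N /(_ N (leqnn N)) ->] := prfin x.
elim/big_ind: _ => [|_ _ [u ui <-] [v vi <-]|k _]; last exact: claim.
  by exists 0; [exact: cdeg0|rewrite diff0].
by exists (u + v); [exact: cdegD|rewrite diffD].
Qed.

End Graded.

(** * First Koszul cohomology *)

Section KoszulOne.
Variables (R : comNzRingType) (M : lmodType R).
Implicit Types (rs : seq R) (c : R -> M).

Fixpoint koszul_const rs (m : M) : koszul rs M :=
  if rs is r :: rs' return koszul rs M then (koszul_const rs' m, 0) else m.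

(** The 1-cochain with coordinate [c r] at the generator [r]. The index is the ring element and not
    its position, so repeated entries get equal coordinates. *)
Fixpoint koszul_cochain rs c : koszul rs M :=
  if rs is r :: rs' return koszul rs M
  then (koszul_cochain rs' c, koszul_const rs' (c r)) else 0.

Lemma eq_koszul_cochain rs c c' :
  {in rs, c =1 c'} <-> koszul_cochain rs c = koszul_cochain rs c'.
Proof.
have constI s : injective (koszul_const s).
  by elim: s => [|r s IH] m m' //= [/IH].
elim: rs => [|r rs IH] /=; first by split.
split=> [cc'|[/IH cc' /constI crr] s].
  rewrite cc' ?mem_head //; congr (_, _); apply/IH => s srs.
  by apply: cc'; rewrite inE srs orbT.
by rewrite inE => /predU1P[->|/cc'].
Qed.

Lemma koszul_cochainZ rs r c :
  r *: koszul_cochain rs c = koszul_cochain rs (fun s => r *: c s).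
Proof.
have constZ s a m : a *: koszul_const s m = koszul_const s (a *: m).
  by elim: s => [|t s IH] //=; congr (_, _); rewrite /= ?IH ?scaler0.
elim: rs => [|s rs IH] /=; first by rewrite scaler0.
by congr (_, _); rewrite /= ?IH ?constZ.
Qed.

Lemma diff_koszul_const rs m :
  diff (koszul_const rs m) = koszul_cochain rs (fun r => r *: m).
Proof.
elim: rs => [|r rs IH] //=; congr (_, _) => //=; rewrite diff0 subr0.
by elim: rs {IH} => [|s rs IH] //=; congr (_, _); rewrite /= ?IH ?scaler0.
Qed.

(** The commutation relations are the cocycle condition for the cochain of [c], and an element of
    degree 0 is a single [m], whose coboundary has coordinates r m. *)
Lemma exact_koszul_one rs c :
  exact_at (koszul rs M) 1 ->
  {in rs &, forall r s, r *: c s = s *: c r} ->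
  exists m, {in rs, forall r, c r = r *: m}.
Proof.
move=> ex comm.
have const_deg s m : cdeg 0 (koszul_const s m).
  by elim: s => [|r s IH] //=; split=> //=; apply: cdeg0.
have coch_deg s : cdeg 1 (koszul_cochain s c).
  by elim: s => [|r s IH] //=; split=> //=; apply: const_deg.
have coch_diff : diff (koszul_cochain rs c) = 0.
  elim: rs comm {ex} => [|r rs IH] //= comm; congr (_, _) => /=.
    apply: IH => s t srs trs; apply: comm; by rewrite inE ?srs ?trs orbT.
  rewrite diff_koszul_const koszul_cochainZ.
  apply/eqP; rewrite subr_eq0; apply/eqP/eq_koszul_cochain => s srs.
  by apply: comm; rewrite inE ?eqxx ?srs ?orbT.
have neg s (j : int) (x : koszul s M) : j < 0 -> cdeg j x -> x = 0.
  elim: s j x => [|r s IH] j x j0 /=; first by apply; rewrite lt_eqF.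
  case: x => a b [/= ai bi]; have j1 : j - 1 < 0 by clear -j0; lia.
  by congr (_, _); [exact: IH ai|exact: IH bi].
have const0 s (x : koszul s M) : cdeg 0 x -> exists m, x = koszul_const s m.
  elim: s x => [|r s IH] x; first by exists x.
  by case: x => a b [/= /IH[m ->] /neg ->] //; exists m.
have [y yd yE] := ex _ (coch_deg rs) coch_diff.
rewrite subrr in yd; have [m ym] := const0 _ _ yd.
exists m => r rrs; move: yE; rewrite ym diff_koszul_const.
by move/eq_koszul_cochain => /(_ r rrs) ->.
Qed.

End KoszulOne.

(** * Quotients by homogeneous ideals *)

Section SeqQuot.
Variables (R : comNzRingType) (V : lmodType R) (rs : seq R).

Definition seq_quot_pi (v : V) : seq_quot V rs := \pi_(seq_quot V rs)%qT v.

Fact seq_quot_pi_linear : linear seq_quot_pi.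
Proof.
move=> a u v; rewrite /seq_quot_pi raddfD; congr (_ + _).
exact/esym/seq_quot_scale_pi.
Qed.

HB.instance Definition _ :=
  GRing.isLinear.Build R V (seq_quot V rs) _ seq_quot_pi seq_quot_pi_linear.

Lemma seq_quot_eq0 v : seq_quot_pi v = 0 <-> seq_mul rs v.
Proof.
rewrite -(linear0 seq_quot_pi); split=> [/eqP|v0]; last apply/eqP.
  by rewrite -Quotient.idealrBE subr0 => /asboolP.
by rewrite -Quotient.idealrBE subr0; apply/asboolP.
Qed.

Lemma seq_quot_piK (x : seq_quot V rs) : seq_quot_pi (repr x) = x.
Proof. exact: reprK. Qed.

End SeqQuot.

Section HomogeneousQuotient.
Variables (K : fieldType) (n : nat).
Local Notation R := {mpoly K[n]}.
Implicit Types (r v : R) (rs : seq R).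

Definition homogeneous rs : Prop := forall r, r \in rs -> exists e, r \is e.-homog.

Lemma pihomogM e r k v : r \is e.-homog ->
  pihomog mdeg k (r * v) = if (e <= k)%N then r * pihomog mdeg (k - e) v else 0.
Proof.
move=> re; have [N vN] : exists N, v = \sum_(d < N) pihomog mdeg d v.
  by exists (mmeasure mdeg v); apply: pihomog_partitionE.
rewrite [in LHS]vN [in RHS]vN; elim/big_rec: _ => [|d w _ IH].
  by rewrite mulr0 !linear0 mulr0 if_same.
rewrite mulrDr !linearD /= IH mulrDr; case: ifP => [ek|ek]; last first.
  rewrite addr0; apply: (@pihomog_ne0 _ _ _ (e + d)%N); last exact/dhomogM/pihomogP.
  by apply: contraFneq ek => <-; apply: leq_addr.
congr (_ + _); have [<-|ne] := eqVneq (e + d)%N k.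
  by rewrite addKn pihomog_id pihomog_dE //; apply/dhomogM/pihomogP.
have hrw : r * pihomog mdeg d v \is (e + d).-homog by apply/dhomogM/pihomogP.
rewrite (pihomog_ne0 ne hrw) (@pihomog_ne0 _ _ _ d) ?mulr0 ?pihomogP //.
by apply: contraNneq ne => ->; rewrite subnKC.
Qed.

Lemma seq_mul_pihomog rs k v :
  homogeneous rs -> seq_mul (V := R^o) rs v -> seq_mul (V := R^o) rs (pihomog mdeg k v).
Proof.
move=> hrs; elim/seq_mul_ind => [|u w|r w rin]; first by rewrite linear0; apply: seq_mul0.
  by rewrite linearD; apply: seq_mulD.
have [e re] := hrs r rin; rewrite /GRing.scale /= (pihomogM _ _ re).
by case: ifP => _; [apply: (@seq_mul_mem R R^o)|apply: seq_mul0].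
Qed.

(** The component of degree d of [b * v] is [b] times the constant coefficient of [v], a unit of the
    field. *)
Lemma seq_mul_homogM rs d b v : homogeneous rs -> b \is d.-homog -> v@_0%MM != 0 ->
  seq_mul (V := R^o) rs (b * v) -> seq_mul (V := R^o) rs b.
Proof.
move=> hrs bd v0 /(seq_mul_pihomog d hrs); rewrite (pihomogM _ _ bd) leqnn subnn.
have -> : pihomog mdeg 0 v = (v@_0%MM)%:MP.
  rewrite pihomogE; have [min|mnin] := boolP (0%MM \in msupp v); last first.
    by rewrite mcoeff_eq0 mnin in v0.
  rewrite big_mkcond (bigD1_seq 0%MM) ?msupp_uniq //= mdeg0 eqxx mpolyX0.
  rewrite big1 ?addr0 ?alg_mpolyC // => m /negPf m0.
  by rewrite mdeg_eq0 m0.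
move=> H; have := seq_mulZ (V := R^o) ((v@_0%MM)^-1)%:MP H.
by rewrite /GRing.scale /= mulrCA -mpolyCM mulVf // mulr1.
Qed.

(** Components are taken on representatives; homogeneity of the ideal makes the result independent
    of the choice. *)
Lemma graded_seq_quot rs : homogeneous rs ->
  graded (fun e r => r \is e.-homog) (module_complex (seq_quot R^o rs)).
Proof.
move=> hrs; pose pi := @seq_quot_pi R R^o rs.
have piE k v : pi (pihomog mdeg k (repr (pi v))) = pi (pihomog mdeg k v).
  apply/eqP; rewrite -subr_eq0 /pi -!linearB; apply/eqP/seq_quot_eq0.
  apply: seq_mul_pihomog => //; apply/(seq_quot_eq0 (V := R^o)).
  by rewrite linearB /= seq_quot_piK subrr.
have pi0 : pi 0 = 0 by rewrite /pi linear0.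
have prj0 k : pi (pihomog mdeg k (repr (0 : seq_quot R^o rs))) = 0.
  by rewrite -pi0 piE pihomog0.
have piD u v : pi (u + v) = pi u + pi v by rewrite /pi linearD.
have piZ r (u : R) : r *: pi u = pi (r * u) by rewrite /pi -linearZ.
exists (fun k x => pi (pihomog mdeg k (repr x))); split=> //.
- move=> k x y; rewrite -[x]seq_quot_piK -[y]seq_quot_piK -/pi.
  by rewrite -piD !piE -piD pihomogD.
- by move=> k i x xi i0; rewrite xi // prj0.
- by move=> k x; rewrite /= prj0.
- move=> x; exists (mmeasure mdeg (repr x)) => N ltN.
  by rewrite -linear_sum -(pihomog_partitionE ltN) [RHS]seq_quot_piK.
move=> e r k x re; rewrite -[x]seq_quot_piK -/pi piZ !piE (pihomogM _ _ re).
by case: ifP => _; rewrite ?pi0 // piZ.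
Qed.

(* Hartshorne's connectedness theorem, in Koszul form: the cocycle is [0] on
   [as_] and the identity on [bs], i.e. the section of the structure sheaf that
   is [0] on V(bs) and [1] on V(as_). *)
Lemma not_exact_koszul_connected rs as_ bs ts a b :
  homogeneous rs -> homogeneous as_ -> homogeneous bs ->
  (forall t, t \in ts -> exists2 e, t \is e.-homog & (0 < e)%N) ->
  {in as_ & bs, forall a b, seq_mul (V := R^o) rs (a * b)} ->
  a \in as_ -> ~ seq_mul (V := R^o) rs a ->
  b \in bs -> b \notin as_ -> ~ seq_mul (V := R^o) rs b ->
  ~ exact_at (koszul (ts ++ as_ ++ bs) (seq_quot R^o rs)) (1 + (size ts)%:Z).
Proof.
move=> hrs has hbs hts ab aas aJ bbs bas bJ; set M := seq_quot R^o rs.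
have gr s : homogeneous s -> graded (fun e r => r \is e.-homog) (koszul s M).
  elim: s => [_|r s IH hs]; first exact: graded_seq_quot.
  have [e re] := hs r (mem_head _ _); apply: (graded_cone re).
  by apply: IH => t ts'; apply: hs; rewrite inE ts' orbT.
have habs : homogeneous (as_ ++ bs).
  by move=> r; rewrite mem_cat => /orP[/has|/hbs].
(* Each element of [ts] is removed by graded Nakayama at the cost of one degree. *)
elim: ts hts => [_|t ts IH hts] /=; last first.
  have hts' s : s \in ts -> exists2 e, s \is e.-homog & (0 < e)%N.
    by move=> sts; apply: hts; rewrite inE sts orbT.
  move=> ex; apply: (IH hts').
  have [e te e0] := hts t (mem_head _ _).
  apply: (graded_nakayama (hom := fun e r => r \is e.-homog) te e0); last first.
    by rewrite -addrA [_ + 1]addrC -intS.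
  apply: gr => s; rewrite mem_cat => /orP[/hts'[d]|/habs //].
  by exists d.
rewrite addr0; pose pi := @seq_quot_pi R R^o rs.
have piZ r (u : R) : r *: pi u = pi (r * u) by rewrite /pi -linearZ.
move=> /(exact_koszul_one (c := fun r => if r \in as_ then 0 else pi r))[|m mE].
  move=> r s; rewrite !mem_cat; have [ras _|ras /= rbs] := boolP (r \in as_).
    have [sas _|sas /= sbs] := boolP (s \in as_); first by rewrite !scaler0.
    by rewrite scaler0 piZ; apply/seq_quot_eq0/ab.
  have [sas _|sas /= sbs] := boolP (s \in as_).
    rewrite scaler0 piZ; apply/esym/seq_quot_eq0.
    by apply: ab.
  by rewrite !piZ mulrC.
pose v : R := repr m; have mv : m = pi v by rewrite /pi seq_quot_piK.
(* A primitive [v] satisfies a v = 0 and b v = b modulo the ideal. Either [v] or [1 - v] has nonzero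
   constant coefficient, which forces [a] or [b] into the ideal. *)
have [v0|v0] := eqVneq (v@_0%MM) 0; last first.
  have [e ae] := has a aas; apply: aJ; apply: (seq_mul_homogM hrs ae v0).
  apply/(seq_quot_eq0 (V := R^o)).
  by rewrite -/pi -piZ -mv -mE ?mem_cat ?aas.
have [e be] := hbs b bbs; apply: bJ; apply: (seq_mul_homogM (v := 1 - v) hrs be).
  by rewrite mcoeffB mcoeff1 eqxx v0 subr0 oner_neq0.
rewrite mulrBr mulr1; apply/(seq_quot_eq0 (V := R^o)).
rewrite linearB /= -/pi -piZ -mv -mE ?mem_cat ?bbs ?orbT //.
by rewrite (negPf bas) subrr.
Qed.

(** Membership in the ideal of the first k variables is read off monomials, and multiplication by
    the next variable leaves the earlier exponents unchanged. *)
Lemma weakly_regular_variables : weakly_regular R^o [seq 'X_i : R | i <- enum 'I_n].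
Proof.
have nthX k (kn : (k < n)%N) : [seq 'X_i : R | i <- enum 'I_n]`_k = 'X_(Ordinal kn).
  rewrite (nth_map (Ordinal kn)) ?size_enum_ord //.
  by rewrite (_ : nth _ _ _ = Ordinal kn) //; apply/val_inj/nth_enum_ord.
pose low k v := forall m, v@_m != 0 -> exists2 i : 'I_n, (i < k)%N & (0 < m i)%N.
have takeP k r : (k <= n)%N -> r \in take k [seq 'X_i : R | i <- enum 'I_n] ->
    exists2 i : 'I_n, (i < k)%N & r = 'X_i.
  move=> kn /(nthP 0)[i]; rewrite size_take_min size_map size_enum_ord.
  rewrite leq_min => /andP[ik ltin]; rewrite nth_take // nthX => <-.
  by exists (Ordinal ltin).
have takeX k (i : 'I_n) : (i < k)%N -> ('X_i : R) \in take k [seq 'X_i | i <- enum 'I_n].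
  move=> ik; apply/(nthP 0); exists i.
    by rewrite size_take_min size_map size_enum_ord leq_min ik ltn_ord.
  by rewrite nth_take // (nthX _ (ltn_ord i)) (_ : Ordinal _ = i) //; apply/val_inj.
have lowP k v : (k <= n)%N ->
    seq_mul (V := R^o) (take k [seq 'X_i | i <- enum 'I_n]) v <-> low k v.
  move=> kn; split=> [|lv].
    elim/seq_mul_ind => [m|u w lu lw m|r w /(takeP _ _ kn)[i ik ->] m].
    - by rewrite mcoeff0 eqxx.
    - rewrite mcoeffD; have [->|/lu//] := eqVneq u@_m 0.
      by rewrite add0r; apply: lw.
    rewrite /GRing.scale /= mulrC => m0; exists i => //.
    rewrite lt0n; apply: contraNneq m0 => mi0.
    rewrite mcoeffM big1 // => -[m1 m2] /= /eqP mE.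
    rewrite mcoeffX; case: eqP => [m2E|]; rewrite ?mulr0 //.
    by have := mnmDE i m1 m2; rewrite -mE mi0 -m2E mnm1E eqxx addn1.
  rewrite (mpolyE v); apply: seq_mul_sum => m; rewrite mcoeff_msupp => /lv[i ik mi] _.
  have -> : 'X_[m] = 'X_[(m - U_(i))%MM] * 'X_i :> R.
    rewrite -mpolyXD submK //; apply/mnm_lepP => j; rewrite mnm1E.
    by case: eqP => // <-.
  rewrite -mul_mpolyC mulrA mulrC.
  exact/(@seq_mul_mem R R^o)/takeX.
move=> k; rewrite size_map size_enum_ord => kn v.
rewrite (nthX _ kn) => /(lowP _ _ (ltnW kn)) H; apply/(lowP _ _ (ltnW kn)) => m m0.
have [|i ik] := H (U_(Ordinal kn) + m)%MM.
  by rewrite /GRing.scale /= mulrC mcoeffMX.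
rewrite mnmDE mnm1E; case: eqP => [iE|_]; last by exists i.
by rewrite -iE ltnn in ik.
Qed.

End HomogeneousQuotient.

(** * A system of parameters *)

Section Radical.
Variables (R : comNzRingType) (I : seq R).
Implicit Types a b r s : R.
Local Notation ideal := (seq_mul (V := R^o) I).

Lemma idealM a r : ideal r -> ideal (a * r).
Proof. exact: (@seq_mulZ R R^o). Qed.

Lemma ideal_gen r : r \in I -> ideal r.
Proof.
by move=> rI; have := @seq_mul_mem R R^o I r 1 rI; rewrite /GRing.scale /= mulr1.
Qed.

Lemma ideal_prodB (J : Type) (s : seq J) (P : pred J) (F G : J -> R) :
  (forall j, P j -> ideal (F j - G j)) ->
  ideal (\prod_(j <- s | P j) F j - \prod_(j <- s | P j) G j).
Proof.
move=> FG; elim/big_rec2: _ => [|j a b Pj ab]; first by rewrite subrr; apply: seq_mul0.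
have -> : F j * b - G j * a = F j * (b - a) + a * (F j - G j) by ring.
by apply: seq_mulD; apply: idealM => //; apply: FG.
Qed.

Lemma ideal_expB a b N : ideal (a - b) -> ideal (a ^+ N - b ^+ N).
Proof.
move=> ab; have := @ideal_prodB _ (index_enum 'I_N) xpredT (fun=> a) (fun=> b).
by rewrite !prodr_const card_ord; apply.
Qed.

Lemma radical_ideal r : ideal r -> in_radical I r.
Proof. by exists 1%N; rewrite expr1. Qed.

Lemma radicalX r N : in_radical I (r ^+ N) -> in_radical I r.
Proof. by move=> [m]; rewrite -exprM; exists (N * m)%N. Qed.

Lemma radicalM a r : in_radical I r -> in_radical I (a * r).
Proof. by move=> [N rN]; exists N; rewrite exprMn; apply: idealM. Qed.

Lemma radicalD r s : in_radical I r -> in_radical I s -> in_radical I (r + s).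
Proof.
move=> [N rN] [m sm]; exists (N + m)%N; rewrite exprDn.
apply: seq_mul_sum => -[i /= ilt] _ _; rewrite -mulr_natr mulrC; apply: idealM.
have [le|/ltnW le] := leqP m i.
  by rewrite -[i](subnK le) exprD mulrA; apply: idealM.
have leN : (N <= N + m - i)%N by lia.
by rewrite -(subnK leN) exprD mulrC mulrA; apply: idealM.
Qed.

Lemma radicalN r : in_radical I r -> in_radical I (- r).
Proof. by rewrite -mulN1r; apply: radicalM. Qed.

Lemma radicalB r s : in_radical I r -> in_radical I s -> in_radical I (r - s).
Proof. by move=> ? ?; apply/radicalD/radicalN. Qed.

Lemma radical_sum (J : Type) (s : seq J) (P : pred J) (F : J -> R) :
  (forall j, P j -> in_radical I (F j)) -> in_radical I (\sum_(j <- s | P j) F j).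
Proof.
move=> FP; elim/big_rec: _ => [|j x Pj]; first exact/radical_ideal/seq_mul0.
exact/radicalD/FP.
Qed.

Lemma radical_congr r s : ideal (r - s) -> in_radical I s -> in_radical I r.
Proof.
by move=> rs ?; rewrite -[r](subrK s); apply/radicalD => //; apply: radical_ideal.
Qed.

End Radical.

Section SystemOfParameters.
Variables (R : comNzRingType) (T : finType) (d : nat).
Implicit Types (x y : T -> R) (U : {set T}) (k : nat).

Definition set_monomial x U : R := \prod_(v in U) x v.

(** The elementary symmetric polynomial of degree [k] in the [x v]. *)
Definition monomial_sum x k : R := \sum_(U : {set T} | #|U| == k) set_monomial x U.

(* All of the degree [d`!], so that the sums in [parameters] are homogeneous. *)
Definition equalized_sum x k : R :=
  if (0 < k < d)%N then monomial_sum x k ^+ (d`! %/ k) else 0.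

(* On the rank one matrices [x v = s * c v], [y v = t * c v], these are
   [s ^+ D * A (i + 1) + t ^+ D * A i] for the values [A k] at [c] of the
   equalized sums: they vanish together only if [A = 0] or [s = t = 0]. *)
Definition parameters x y : seq R :=
  [seq equalized_sum x i.+1 + equalized_sum y i | i <- iota 0 d].

Variable I : seq R.

(** Descending induction on the size of [U]. The monomial of [U] times the symmetric sum of its
    degree is its square plus terms indexed by W != U, each divisible by the monomial of the
    strictly larger union of [U] and [W]. *)
Lemma radical_set_monomial w x :
  (forall U, (d <= #|U|)%N -> in_radical I (set_monomial x U)) ->
  (forall k, in_radical I (w * equalized_sum x k)) ->
  forall U, (0 < #|U|)%N -> in_radical I (w * set_monomial x U).
Proof.
move=> big sums U; have [m] := ubnP (#|T| - #|U|)%N.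
elim: m U => // m IH U; rewrite ltnS => Um U0.
have [/big ?|Ud] := leqP d #|U|; first exact: radicalM.
have fw : in_radical I (w * monomial_sum x #|U|).
  have := sums #|U|; rewrite /equalized_sum U0 Ud /= => H.
  (* The exponent must be positive, so that the same power of [w] contains a factor [w]. *)
  have dU : (0 < d`! %/ #|U|)%N.
    rewrite divn_gt0 //; apply: (leq_trans (ltnW Ud)).
    by case: (d) => // d'; rewrite factS leq_pmulr // fact_gt0.
  apply: (@radicalX _ _ _ (d`! %/ #|U|)); rewrite exprMn.
  by rewrite -(prednK dU) [w ^+ _]exprS mulrAC mulrC [in w * _]prednK //; apply: radicalM.
apply: (@radicalX _ _ _ 2).
have -> : (w * set_monomial x U) ^+ 2 =
    w * set_monomial x U * (w * monomial_sum x #|U|) -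
    \sum_(W : {set T} | (#|W| == #|U|) && (W != U))
       w * w * set_monomial x (U :&: W) * set_monomial x (U :|: W).
  rewrite /monomial_sum (bigD1 U) //= mulrDr mulrDr !mulr_sumr.
  rewrite [X in _ = _ + X - _](_ : _ = \sum_(W : {set T} | (#|W| == #|U|) && (W != U))
       w * w * set_monomial x (U :&: W) * set_monomial x (U :|: W)) ?addrK; first by ring.
  apply: eq_bigr => W _.
  have -> : set_monomial x W = set_monomial x (W :&: U) * set_monomial x (W :\: U).
    by rewrite /set_monomial (big_setID U).
  have -> : set_monomial x (U :|: W) = set_monomial x U * set_monomial x (W :\: U).
    by rewrite /set_monomial (big_setID U) /= setUK setDUl setDv set0U.
  by rewrite setIC; ring.
apply: radicalB; first exact: radicalM.
apply: radical_sum => W /andP[/eqP cW nW].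
rewrite -mulrA mulrCA mulrA -mulrA -mulrA; apply: radicalM; apply: radicalM.
have UW : (#|U| < #|U :|: W|)%N.
  apply: proper_card; rewrite properE subsetUl /=; apply: contra nW => sub.
  by rewrite eqEcard cW leqnn andbT (subset_trans (subsetUr U W)).
have UWT : (#|U :|: W| <= #|T|)%N by rewrite -cardsT subset_leq_card ?subsetT.
by apply: IH; lia.
Qed.

Variables (x y : T -> R).
Hypothesis minors : forall u v, seq_mul (V := R^o) I (x u * y v - x v * y u).

(** The minors give x_w^k e_k(y) = y_w^k e_k(x) modulo the ideal, monomial by monomial; raising to
    the power d!/k yields the exponent d!. *)
Lemma equalized_sum_rank1 w k :
  seq_mul (V := R^o) I (x w ^+ d`! * equalized_sum y k - y w ^+ d`! * equalized_sum x k).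
Proof.
rewrite /equalized_sum; case: ifP => [/andP[k0 kd]|_]; last first.
  by rewrite !mulr0 subrr; apply: seq_mul0.
have dk : d`! = (k * (d`! %/ k))%N.
  by rewrite mulnC divnK // dvdn_fact // k0 ltnW.
rewrite {1 3}dk !exprM -!exprMn; apply: ideal_expB.
rewrite /monomial_sum !mulr_sumr -sumrB; apply: seq_mul_sum => U _ /eqP <-.
rewrite -!prodr_const -!big_split /=; apply: ideal_prodB => v _.
by rewrite [y w * _]mulrC.
Qed.

(** Where [x w] is invertible, the sum of [y] is (y_w / x_w)^(d!) times that of [x]. The power d! +
    1 clears the denominator and leaves one factor [x w]. *)
Lemma radical_rank1 w k :
  in_radical I (x w * equalized_sum x k) -> in_radical I (x w * equalized_sum y k).
Proof.
move=> rx; apply: (@radicalX _ _ _ d`!.+1).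
have -> : (x w * equalized_sum y k) ^+ d`!.+1 =
    equalized_sum y k ^+ d`! * (x w * (x w ^+ d`! * equalized_sum y k)).
  by rewrite exprMn !exprS; move: (x w ^+ _) (equalized_sum y k ^+ _) => p q; ring.
apply: radicalM.
apply: (@radical_congr _ _ _ (y w ^+ d`! * (x w * equalized_sum x k))).
  have -> : x w * (x w ^+ d`! * equalized_sum y k) -
      y w ^+ d`! * (x w * equalized_sum x k) =
      x w * (x w ^+ d`! * equalized_sum y k - y w ^+ d`! * equalized_sum x k) by ring.
  exact/idealM/equalized_sum_rank1.
exact: radicalM.
Qed.

End SystemOfParameters.

(** For [x v] the sums are killed in increasing order, starting from index 0: rank one passes from
    the sum of [x] at k to that of [y], and a parameter from there to the sum of [x] at k + 1. For
    [y v] the exchange runs downwards from the sums of index >= d, which are 0. *)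
Lemma radical_variables (R : comNzRingType) (T : finType) (d : nat) (I : seq R)
    (x y : T -> R) :
  (forall u v, seq_mul (V := R^o) I (x u * y v - x v * y u)) ->
  (forall U : {set T}, (d <= #|U|)%N -> in_radical I (set_monomial x U)) ->
  (forall U : {set T}, (d <= #|U|)%N -> in_radical I (set_monomial y U)) ->
  {subset parameters d x y <= I} ->
  forall v, in_radical I (x v) /\ in_radical I (y v).
Proof.
move=> minors bigx bigy sub v.
have minors' u w : seq_mul (V := R^o) I (y u * x w - y w * x u).
  by rewrite mulrC [y w * _]mulrC; apply: minors.
have par i : (i < d)%N -> in_radical I (equalized_sum d x i.+1 + equalized_sum d y i).
  by move=> id; apply/radical_ideal/ideal_gen/sub/map_f; rewrite mem_iota.
have eq0 z k : (d <= k)%N -> equalized_sum d z k = 0 :> R.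
  by move=> dk; rewrite /equalized_sum [(k < d)%N]ltnNge dk andbF.
have rad0 : in_radical I 0 by apply/radical_ideal/seq_mul0.
(* With weight [z v] and U = {v} the product is the square of [z v]. *)
have final z : (forall U : {set T}, (d <= #|U|)%N -> in_radical I (set_monomial z U)) ->
    (forall k, in_radical I (z v * equalized_sum d z k)) -> in_radical I (z v).
  move=> bigz sums; apply: (@radicalX _ _ _ 2).
  have := radical_set_monomial bigz sums (U := [set v]).
  by rewrite /set_monomial big_set1 cards1 expr2; apply.
split; apply: final => //.
  elim=> [|k IH]; first by rewrite /equalized_sum mulr0.
  have [/eq0 ->|kd] := leqP d k.+1; first by rewrite mulr0.
  rewrite -[equalized_sum d x _](addrK (equalized_sum d y k)) mulrBr.
  by apply: radicalB; [apply/radicalM/par/ltnW|apply: radical_rank1].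
move=> k; have [m] := ubnP (d - k)%N; elim: m k => // m IH k; rewrite ltnS => km.
have [/eq0 ->|kd] := leqP d k; first by rewrite mulr0.
rewrite -[equalized_sum d y _](addKr (equalized_sum d x k.+1)) mulrDr mulrN.
apply: radicalD; last exact/radicalM/par.
by apply/radicalN/(radical_rank1 minors'); apply: IH; lia.
Qed.

(** * Binomial edge ideals *)

(** Fewer than l vertices lie outside [U] and {p, q}, so deleting them leaves a connected graph. A
    path without repetitions there keeps [p] and [q] out of its interior. *)
Lemma vertex_connected_path (T : finType) (e : rel T) (l : nat) (U : {set T}) (p q : T) :
  vertex_connected e l -> (#|T| < l + #|U|)%N -> p != q ->
  exists s, [/\ path e p (rcons s q), uniq s & {subset s <= U}].
Proof.
move=> [_ conn] cU pq; pose S := ~: (U :|: [set p; q]).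
have cS : (#|S| < l)%N.
  have := cardsC (U :|: [set p; q]); have := subset_leq_card (subsetUl U [set p; q]).
  by rewrite -/S; lia.
have pS : p \notin S by rewrite !inE eqxx orbT.
have qS : q \notin S by rewrite !inE eqxx !orbT.
have /connectP[s0 path0] := conn S cS (exist _ p pS) (exist _ q qS).
case/shortenP: path0 => s path_s uniq_s _ /(congr1 val)/= last_s.
have path_vs : path e p (map val s) by rewrite (path_map (f := val) (exist _ p pS)).
have uniq_vs : uniq (p :: map val s).
  by rewrite -(map_inj_uniq val_inj) in uniq_s.
have sub_vs v : v \in map val s -> v \in U :|: [set p; q].
  by move=> /mapP[[w wS] _ ->] /=; rewrite !inE negbK in wS *.
have : last p (map val s) = q by rewrite (last_map val s (exist _ p pS)) last_s.
move: path_vs uniq_vs sub_vs; case: (lastP (map val s)) => [|t w] /=.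
  by move=> _ _ _ pqE; rewrite pqE eqxx in pq.
move=> path_t /andP[pt]; rewrite rcons_uniq => /andP[wt ut] sub; rewrite last_rcons => wq.
rewrite {}wq in path_t pt wt sub; exists t; split=> // v vt.
have := sub v; rewrite mem_rcons inE vt orbT => /(_ isT); rewrite !inE.
case/or3P=> [//||] /eqP vE.
  by rewrite mem_rcons inE -vE vt orbT in pt.
by rewrite -vE vt in wt.
Qed.

Section BinomialEdge.
Variables (K : fieldType) (n : nat).
Local Notation R := {mpoly K[n + n]}.
Local Notation x := (@xvar K n).
Local Notation y := (@yvar K n).
Implicit Types (e : rel 'I_n) (p q v : 'I_n) (U : {set 'I_n}).

Definition minor p q : R := x p * y q - x q * y p.

Lemma minor_edge e p q : e p q -> minor p q \in edge_binomials K e.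
Proof.
move=> epq; apply/mapP; exists (p, q) => //.
by rewrite mem_enum inE.
Qed.

Lemma edge_binomialsP e r :
  r \in edge_binomials K e -> exists2 p : 'I_n * 'I_n, e p.1 p.2 & r = minor p.1 p.2.
Proof. by move=> /mapP[p]; rewrite mem_enum inE => ? ->; exists p. Qed.

(** The hypothesis on [z] is the three-term relation satisfied by both rows [x] and [y] of the
    matrix. It splits the minor of the endpoints at the first interior vertex into an edge minor and
    the minor of a shorter path. *)
Lemma path_minor (z : 'I_n -> R) e s p q :
  (forall v p q, z v * minor p q = z p * minor v q + z q * minor p v) ->
  path e p (rcons s q) ->
  seq_mul (V := R^o) (edge_binomials K e) (\prod_(v <- s) z v * minor p q).
Proof.
move=> zP; elim: s p => [|v s IH] p /=.
  by rewrite andbT big_nil mul1r => /minor_edge/ideal_gen.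
move=> /andP[pv vq].
have -> : \prod_(w <- v :: s) z w * minor p q =
    z p * (\prod_(w <- s) z w * minor v q) + z q * \prod_(w <- s) z w * minor p v.
  by rewrite big_cons mulrAC zP; ring.
by apply: seq_mulD; apply: idealM; [apply: IH|apply/ideal_gen/minor_edge].
Qed.

Lemma set_monomial_minor (z : 'I_n -> R) e l U p q :
  (forall v p q, z v * minor p q = z p * minor v q + z q * minor p v) ->
  vertex_connected e l -> (n < l + #|U|)%N ->
  seq_mul (V := R^o) (edge_binomials K e) (set_monomial z U * minor p q).
Proof.
move=> zP conn cU; have [->|pq] := eqVneq p q.
  by rewrite /minor subrr mulr0; apply: seq_mul0.
have [|s [path_s uniq_s sU]] := vertex_connected_path (U := U) conn _ pq.
  by rewrite card_ord.
have -> : set_monomial z U = \prod_(v in U | v \notin s) z v * \prod_(v <- s) z v.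
  rewrite /set_monomial (bigID (mem s)) mulrC /= [in RHS]big_uniq //; congr (_ * _).
  by apply: eq_bigl => v; case: (boolP (v \in s)) => [/sU ->|]; rewrite ?andbF.
by rewrite -mulrA; apply/idealM/path_minor.
Qed.

Lemma homog_xvar v : x v \is 1.-homog.
Proof. by rewrite dhomogX; apply/eqP/mdeg1. Qed.

Lemma homog_yvar v : y v \is 1.-homog.
Proof. by rewrite dhomogX; apply/eqP/mdeg1. Qed.

Lemma homog_minor p q : minor p q \is 2.-homog.
Proof.
by apply: rpredB; apply: (dhomogM (d := 1%N) (e := 1%N)); rewrite ?homog_xvar ?homog_yvar.
Qed.

Section Sums.
Variable z : 'I_n -> R.
Hypothesis z1 : forall v, z v \is 1.-homog.

Lemma homog_set_monomial U : set_monomial z U \is #|U|.-homog.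
Proof.
rewrite -sum1_card /set_monomial; elim/big_rec2: _ => [|v m r _ IH]; first exact: dhomog1.
exact: dhomogM.
Qed.

Lemma homog_equalized_sum d k : equalized_sum d z k \is (d`!).-homog.
Proof.
rewrite /equalized_sum; case: ifP => [/andP[k0 kd]|_]; last exact: dhomog0.
have hm : monomial_sum z k \is k.-homog.
  by apply: rpred_sum => U /eqP <-; apply: homog_set_monomial.
have -> : d`! = (k * (d`! %/ k))%N by rewrite mulnC divnK // dvdn_fact // k0 ltnW.
by rewrite mulKn //; apply: dhomogMn.
Qed.

End Sums.

(** * Generators of A and B, and elements outside J_G *)

Definition all_minors : seq R := [seq minor pq.1 pq.2 | pq <- enum {: 'I_n * 'I_n}].

Definition big_monomials d : seq R :=
  [seq set_monomial x U | U in [pred U : {set 'I_n} | (d <= #|U|)%N]] ++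
  [seq set_monomial y U | U in [pred U : {set 'I_n} | (d <= #|U|)%N]].

Definition connectivity_seq d : seq R :=
  parameters d x y ++ all_minors ++ big_monomials d.

Lemma connectivity_seq_radical d (i : 'I_(n + n)) :
  in_radical (connectivity_seq d) 'X_i.
Proof.
have monP (z : 'I_n -> R) U : (d <= #|U|)%N -> set_monomial z U \in
    [seq set_monomial z U | U in [pred U : {set 'I_n} | (d <= #|U|)%N]].
  by move=> dU; apply/map_f; rewrite mem_enum inE.
have rad v : in_radical (connectivity_seq d) (x v) /\
    in_radical (connectivity_seq d) (y v).
  apply: (radical_variables (d := d)) => [p q|U dU|U dU|r rp].
  - apply: ideal_gen; rewrite !mem_cat.
    by rewrite (map_f (fun pq => minor pq.1 pq.2) (x := (p, q))) ?orbT ?mem_enum.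
  - by apply/radical_ideal/ideal_gen; rewrite !mem_cat monP ?orbT.
  - by apply/radical_ideal/ideal_gen; rewrite !mem_cat monP ?orbT.
  - by rewrite mem_cat rp.
by rewrite -(splitK i); case: (split i) => v; have [] := rad v.
Qed.

(* Both evaluations below kill the ideal of [e]: the first all the minors, the
   second all the minors but those of [p, q]. *)
Lemma meval_edge_binomials (c : 'I_(n + n) -> K) e r :
  (forall p q, e p q -> meval c (minor p q) = 0) ->
  seq_mul (V := R^o) (edge_binomials K e) r -> meval c r = 0.
Proof.
move=> ec; elim/seq_mul_ind => [|u v u0 v0|s v /edge_binomialsP[p ep ->]].
- exact: meval0.
- by rewrite mevalD u0 v0 addr0.
by rewrite /GRing.scale /= mevalM ec // mul0r.
Qed.

Lemma meval_minor c p q : meval c (minor p q) =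
  c (lshift n p) * c (rshift n q) - c (lshift n q) * c (rshift n p).
Proof. by rewrite mevalB !mevalM !mevalXU. Qed.

Lemma meval1_minor p q : meval (fun=> 1) (minor p q) = 0.
Proof. by rewrite meval_minor subrr. Qed.

Lemma meval1_set_monomial U : meval (fun=> 1) (set_monomial x U) = 1.
Proof.
rewrite /set_monomial; elim/big_rec: _ => [|v r _ IH]; first exact: meval1.
by rewrite mevalM mevalXU mul1r.
Qed.

Lemma minor_notin_ideal e p q : p != q -> ~~ e p q -> ~~ e q p ->
  ~ seq_mul (V := R^o) (edge_binomials K e) (minor p q).
Proof.
move=> pq epq eqp.
(* The matrix whose rows are the indicators of [p] and of [q]. *)
pose c (i : 'I_(n + n)) : K := ((i == lshift n p) || (i == rshift n q))%:R.
have cx v : c (lshift n v) = (v == p)%:R.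
  by rewrite /c eq_lrshift orbF (inj_eq (@lshift_inj _ _)).
have cy v : c (rshift n v) = (v == q)%:R.
  by rewrite /c eq_rlshift (inj_eq (@rshift_inj _ _)).
have ec u v : e u v -> meval c (minor u v) = 0.
  move=> euv; rewrite meval_minor !cx !cy -!natrM !mulnb.
  have [/andP[/eqP uE /eqP vE]|_] := boolP ((u == p) && _).
    by rewrite uE vE (negPf epq) in euv.
  have [/andP[/eqP vE /eqP uE]|_] := boolP ((v == p) && _); last by rewrite subrr.
  by rewrite uE vE (negPf eqp) in euv.
move/(meval_edge_binomials ec)/eqP; rewrite meval_minor !cx !cy !eqxx.
by rewrite (eq_sym q p) (negPf pq) mul0r subr0 mulr1 oner_eq0.
Qed.

(** The elements outside J_G are the minor of a nonadjacent pair and the product of all [x v]; the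
    latter is in [big_monomials] because l > 0 gives n >= n - l + 1. *)
Lemma connectivity_not_exact e l :
  simple_graph e -> ~ complete_graph e -> vertex_connected e l -> (0 < l)%N ->
  ~ exact_at (koszul (connectivity_seq (n - l).+1) (binomial_edge_ring K e))
      (1 + (n - l).+1%:Z).
Proof.
move=> [sym irr] ncomp conn l0; set d := (n - l).+1.
have ln : (l < n)%N by have [] := conn; rewrite card_ord.
have [p [q [pq epq]]] : exists p q, p != q /\ ~~ e p q.
  apply: contrapT => H; apply: ncomp => p q pq; apply/negP => epq; apply: H.
  by exists p, q; split=> //; apply/negP.
have szp : size (parameters d x y) = d by rewrite size_map size_iota.
rewrite -[X in 1 + X%:Z]szp.
apply: (@not_exact_koszul_connected K (n + n) _ all_minors (big_monomials d) _
  (minor p q) (set_monomial x setT)).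
- by move=> _ /edge_binomialsP[pq' _ ->]; exists 2%N; apply: homog_minor.
- by move=> _ /mapP[pq' _ ->]; exists 2%N; apply: homog_minor.
- move=> r; rewrite mem_cat => /orP[] /mapP[U _ ->]; exists #|U|.
    exact/homog_set_monomial/homog_xvar.
  exact/homog_set_monomial/homog_yvar.
- move=> _ /mapP[i _ ->]; exists d`!; last exact: fact_gt0.
  by apply: rpredD; apply: homog_equalized_sum; [apply: homog_xvar|apply: homog_yvar].
- move=> _ r /mapP[[u v] _ ->] /=; rewrite mulrC mem_cat.
  have cU U : (d <= #|U|)%N -> (n < l + #|U|)%N by rewrite /d; lia.
  by case/orP=> /mapP[U]; rewrite mem_enum inE => /cU dU ->;
    apply: (set_monomial_minor _ _ _ conn) => // w i j; rewrite /minor; ring.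
- by apply/mapP; exists (p, q); rewrite ?mem_enum.
- by apply: minor_notin_ideal => //; rewrite -sym.
- rewrite mem_cat; apply/orP; left; apply/map_f; rewrite mem_enum inE cardsT card_ord.
  by rewrite /d; lia.
- apply/negP => /mapP[uv _ /(congr1 (meval (fun=> 1)))].
  by rewrite meval1_set_monomial meval1_minor => /eqP; rewrite oner_eq0.
- move/(meval_edge_binomials (c := fun=> 1)) => H.
  have /eqP := H (fun u v _ => meval1_minor u v).
  by rewrite meval1_set_monomial oner_eq0.
Qed.

End BinomialEdge.

(** * Depth and projective dimension of R/J_G *)

Theorem theorem2 (K : fieldType) (n : nat) (e : rel 'I_n) (l : nat) :
  simple_graph e ->
  connected_graph e ->
  ~ complete_graph e ->
  is_vertex_connectivity e l ->
  depth_at_most (@homogeneous_maximal_ideal K n) (binomial_edge_ring K e)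
    (n - l + 2) /\
  proj_dim_at_least (binomial_edge_ring K e) (n + l - 2).
Proof.
move=> simple conn ncomp [vconn max].
have ln : (l < n)%N by have [] := vconn; rewrite card_ord.
(* A graph that is not complete has n > 1. Being connected, it is then 1-vertex-connected, and
   maximality of [l] applies. *)
have l0 : (0 < l)%N.
  apply: max; split=> [|S].
    rewrite card_ord ltnNge; apply/negP => n1; apply: ncomp => u v /negP[].
    by apply/eqP/val_inj; move: (ltn_ord u) (ltn_ord v) => /=; lia.
  rewrite ltnS leqn0 cards_eq0 => /eqP-> u v.
  have all0 (w : 'I_n) : w \notin set0 by rewrite inE.
  pose h w : {w : 'I_n | w \notin set0} := exist _ w (all0 w).
  have hK w : h (val w) = w by apply/val_inj.
  have /connectP[s path_s vE] := conn (val u) (val v).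
  rewrite -(hK u) -(hK v); apply/connectP; exists (map h s).
    by rewrite (path_map (f := h)).
  by rewrite last_map vE.
pose xs : seq {mpoly K[n + n]} := [seq 'X_i | i <- enum 'I_(n + n)].
have szx : size xs = (n + n)%N by rewrite size_map size_enum_ord.
pose M := binomial_edge_ring K e.
(* Exactness up to degree n - l + 2 = 1 + d, where d = n - l + 1, would pass from [rs] to the
   variables and from there to [connectivity_seq]. *)
have nex rs : (forall i, i <= (n - l + 2)%:Z -> exact_at (koszul rs M) i) ->
    (forall r, r \in rs -> homogeneous_maximal_ideal r) -> False.
  move=> ex rsm.
  have exx : forall i, i <= (n - l + 2)%:Z -> exact_at (koszul (rev xs) M) i.
    apply: exact_koszul_radical ex => r /rsm rx; exists 1%N; rewrite expr1.
    by apply: seq_mul_sub rx => s; rewrite mem_rev.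
  apply: (connectivity_not_exact simple ncomp vconn l0).
  apply: (exact_koszul_radical _ exx); last by lia.
  by move=> r; rewrite mem_rev => /mapP[i _ ->]; apply: connectivity_seq_radical.
(* A regular sequence longer than n - l + 2 would give exactness up to that degree. *)
split=> [rs rsm [reg _]|].
  rewrite leqNgt; apply/negP => lt; apply: (nex (rev rs)) => [i il|r].
    by apply: exact_koszul_regular => //; lia.
  by rewrite mem_rev; apply: rsm.
have [i il nexi] : exists2 i, i <= (n - l + 2)%:Z & ~ exact_at (koszul (rev xs) M) i.
  apply: contrapT => H; apply: (nex (rev xs)) => [i il|r].
    by apply: contrapT => nexi; apply: H; exists i.
  by rewrite mem_rev => /ideal_gen.
(* The bound is 2n - (n - l + 2) = n + l - 2, from the 2n variables. *)
apply: (proj_dim_koszul _ nexi); last by rewrite size_rev szx; lia.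
move=> P projP j; rewrite size_rev => jlt.
exact/exact_koszul_projective/jlt/projP/weakly_regular_variables.
Qed.
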